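(* Let $f \in L^1(\mathbb{R})$. The function $\mathcal{T}f:\mathbb{R}\to[0,\infty)$ is Lebesgue measurable.
   Context: For $f\in L^1(\mathbb{R})$, $x\in\mathbb{R}$ and $r>0$, put $\mathcal{A}_r f(x):=\frac{1}{2r}\int_{-r}^{r} f(x+y)\,dy$. The (centered) Hardy-Littlewood maximal function is $\mathcal{M}f(x):=\sup_{r>0}\mathcal{A}_r|f|(x)\in[0,\infty]$. Put $E_{f,x}:=\{r>0:\mathcal{M}f(x)=\mathcal{A}_r|f|(x)\}$. The frequency function of $f$ is $\mathcal{T}f(x):=\inf E_{f,x}$ if $E_{f,x}$ is nonempty, and $\mathcal{T}f(x):=0$ otherwise. *)

(* Defs.v *)
From HB Require Import structures.
From mathcomp Require Import all_boot all_order all_algebra.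
From mathcomp Require Import all_classical all_reals all_analysis.

Set Implicit Arguments.
Unset Strict Implicit.
Unset Printing Implicit Defensive.

Import Order.TTheory GRing.Theory Num.Theory.
Import numFieldNormedType.Exports.

Local Open Scope classical_set_scope.
Local Open Scope ring_scope.

(* The carrier is convertible to [R], but the canonical sigma-algebra is that of
   the Lebesgue measurable sets (the Caratheodory sigma-algebra of the Lebesgue
   outer measure), whereas the canonical one on [R] is the Borel sigma-algebra.
   It is the domain type of [completed_lebesgue_measure]. *)
Notation lebesgueTypeR R := (caratheodory_type ((wlength (@idfun R))^*)%mu).

Section frequency_function.
Context {R : realType}.
Implicit Types (f : R -> R) (x r : R).

Local Notation leb := (@completed_lebesgue_measure R).

Definition in_L1 f : Prop :=
  leb.-integrable [set: lebesgueTypeR R] (EFin \o f : lebesgueTypeR R -> \bar R).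

Definition average f r x : \bar R :=
  (((2 * r)^-1)%:E *
   \int[leb]_(y in (`[(- r)%R, r]%classic : set (lebesgueTypeR R))) (f (x + y)%R)%:E)%E.

Definition maximal_function f x : \bar R :=
  ereal_sup [set average (fun y => `|f y|) r x | r in [set r : R | 0 < r]].

Definition maximizing_radii f x : set R :=
  [set r | 0 < r /\ maximal_function f x = average (fun y => `|f y|) r x].

Definition frequency f x : R :=
  if `[< maximizing_radii f x !=set0 >] then inf (maximizing_radii f x) else 0.

End frequency_function.

(* Main.v *)
Require Import Defs.
From HB Require Import structures.
From mathcomp Require Import all_boot all_order all_algebra.
From mathcomp Require Import all_classical all_reals all_analysis.
From mathcomp Require Import measurable_realfun lra.

(** Write [A r x] for the average of [|f|] over the interval of radius [r]
around [x].  Once the average is expressed through the primitive [P] of [|f|],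
[A r x = (P (x + r) - P (x - r)) / (2 r)], the continuity of [P] shows that
[A] is continuous in [r > 0] for each fixed [x], and continuous, hence
measurable, in [x] for each fixed [r > 0].

By continuity in [r], the maximal function [M x] is the supremum of [A r x]
over the countably many rational [r > 0], so it is measurable.  The value of
the frequency function is not itself a countable supremum or infimum, but its
level sets are accessible: for [y > 0], the infimum of the set [E x] of
maximizing radii is at least [y] (with the convention that it is [0] when [E x]
is empty) exactly when [E x] is nonempty and misses the open interval
[`]0, y[].  So it suffices that the set of [x] for which [E x] meets a given
open set [D] of radii is measurable ([measurable_maximizer_open]).  Writing [D]
as a countable union of compact intervals [`[p, q]] reduces this to compact
intervals, where the maximum of [A ^~ x] is attained; hence [E x] meets
[`[p, q]] if and only if [M x] equals the supremum of [A r x] over the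
rational [r] in [`]p, q[].  This is an equality of two measurable functions.

The representation through the primitive needs the change of variable
[y |-> x + y] for the completed Lebesgue measure ([ge0_integral_addl]).  The
average involves [f (x + y)] for a Lebesgue measurable [f], so translations
have to be shown to preserve Lebesgue measurable sets, and not only Borel sets;
this is done at the level of the outer measure, by translating covers. *)

Set Implicit Arguments.
Unset Strict Implicit.
Unset Printing Implicit Defensive.

Import Order.TTheory GRing.Theory Num.Theory.
Import numFieldNormedType.Exports.

Local Open Scope classical_set_scope.
Local Open Scope ring_scope.

(** * The least maximizer of a parametrized continuous function *)

Section least_maximizer.
Context {R : realType}.

(** This form, with [r] in the closure of [D], handles both the radii inside an
open set and the endpoints of a compact interval, which may be irrational. *)
Lemma le_ereal_sup_rat (h : R -> R) (D : set R) (r : R) :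
  open D -> closure D r -> {for r, continuous h} ->
  ((h r)%:E <= ereal_sup [set (h q)%:E | q in D `&` range ratr])%E.
Proof.
move=> oD clDr hr; apply/lee_subgt0Pr => e e0.
have : nbhs r [set t | h r - e < h t].
  by apply: (cvgr_gt (h r) hr); rewrite ltrBlDr ltrDl.
rewrite nbhsE => -[U [oU Ur] Uh].
have [t DUt] := clDr U (open_nbhs_nbhs (conj oU Ur)).
have [q [[Dq Uq] Qq]] := dense_rat (ex_intro _ t DUt) (openI oD oU).
apply: (@le_trans _ _ (h q)%:E).
  by rewrite -EFinB lee_fin ltW//; exact: Uh.
by apply: ereal_sup_ubound; exists q.
Qed.

Lemma itvcc_sub_closure_itvoo (p q : R) : p < q -> `[p, q] `<=` closure `]p, q[.
Proof.
move=> pq r /=; rewrite in_itv/= => /andP[pr rq] U /nbhs_ballP[e /= e0 eU].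
have [|t] := @rat_in_itvoo _ (Num.max p (r - e)) (Num.min q (r + e)).
  rewrite gt_max !lt_min; apply/andP; split; apply/andP; split; lra.
rewrite in_itv/= gt_max lt_min => /andP[/andP[pt ret] /andP[tq tre]].
exists (ratr t); split; first by rewrite /= in_itv/= pt.
by apply: eU; rewrite /ball/= ltr_distlC ret.
Qed.

Context d (T : measurableType d) (g : R -> T -> R).

Lemma measurable_ereal_sup_rat (D : set R) :
  (forall r, D r -> measurable_fun setT (g r)) ->
  measurable_fun setT
    ((fun x => ereal_sup [set (g q x)%:E | q in D `&` range ratr]) : T -> \bar R).
Proof.
move=> mg mT; apply: (measurability _ (ErealGenOInfty.measurableE R)) => //.
move=> _ [_ [y ->] <-]; rewrite setTI.
rewrite (_ : _ @^-1` _ =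
    \bigcup_(q in [set q : rat | D (ratr q)]) [set x | (y < g (ratr q) x)]).
  rewrite bigcup_mkcond; apply: countable_bigcupT_measurable => [//|q].
  case: ifPn => // /set_mem Dq.
  have := mg _ Dq mT _ (measurable_itv `]y, +oo[).
  by rewrite setTI; congr measurable; apply/seteqP; split=> x /=;
    rewrite in_itv/= andbT.
apply/seteqP; split=> x /=; rewrite in_itv/= andbT.
  by move=> /ereal_sup_gt[_ [r [Dr [q _ qr]] <-]] yr; exists q; rewrite /= qr.
move=> [q Dq yq]; apply/ereal_sup_gtP; exists (g (ratr q) x)%:E => //.
by exists (ratr q) => //; split => //; exists q.
Qed.

Let M x := ereal_sup [set (g r x)%:E | r in [set r | 0 < r]].
Let E x := [set r | 0 < r /\ M x = (g r x)%:E].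

Hypothesis g_continuous : forall x r, 0 < r -> {for r, continuous (g^~ x)}.
Hypothesis g_measurable : forall r, 0 < r -> measurable_fun setT (g r).

Let maximum_rat x :
  M x = ereal_sup [set (g q x)%:E | q in [set r | 0 < r] `&` range ratr].
Proof.
apply/eqP; rewrite eq_le; apply/andP; split.
  apply/ereal_supP => _ [r r0 <-].
  apply: (@le_ereal_sup_rat (g^~ x)); [exact: open_gt| |exact: g_continuous].
  exact: subset_closure.
by apply: ereal_sup_le => _ [q [q0 _] <-]; exists q.
Qed.

(** On a compact interval the maximum of [g ^~ x] is attained, and it is also
the supremum over the rational points of the interior. *)
Let measurable_maximizer_itvcc p q : 0 < p -> p < q ->
  measurable [set x | E x `&` `[p, q] !=set0].
Proof.
move=> p0 pq.
have -> : [set x | E x `&` `[p, q] !=set0] =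
  setT `&` [set x | M x =
    ereal_sup [set (g r x)%:E | r in `]p, q[ `&` range ratr]].
  rewrite setTI; apply/seteqP; split=> x /=.
    move=> [r [[r0 Mr] rpq]]; apply/eqP; rewrite eq_le; apply/andP; split.
      rewrite Mr; apply: (@le_ereal_sup_rat (g^~ x)); last exact: g_continuous.
        exact: itv_open.
      exact: itvcc_sub_closure_itvoo.
    apply/ereal_supP => _ [s [spq _] <-].
    have ps : p < s by move: spq; rewrite /= in_itv/= => /andP[].
    by apply: ereal_sup_ubound; exists s => //=; exact: lt_trans ps.
  move=> Mpq.
  have [c cpq cmax] : exists2 c, c \in `[p, q] &
      forall t, t \in `[p, q] -> g t x <= g c x.
    apply: (@EVT_max _ (g^~ x)) => //; first exact: ltW.
    apply: continuous_in_subspaceT => t; rewrite inE/= in_itv/= => /andP[pt _].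
    by apply: g_continuous; exact: lt_le_trans pt.
  have c0 : 0 < c.
    by move: cpq; rewrite in_itv/= => /andP[pc _]; exact: lt_le_trans pc.
  exists c; split=> //; split => //; apply/eqP; rewrite eq_le; apply/andP; split.
    rewrite Mpq; apply/ereal_supP => _ [s [spq _] <-]; rewrite lee_fin.
    by apply: cmax; apply: subset_itv_oo_cc spq.
  by apply: ereal_sup_ubound; exists c.
apply: measurable_eqe => //; last first.
  apply: measurable_ereal_sup_rat => r /=; rewrite in_itv/= => /andP[pr _].
  by apply: g_measurable; exact: lt_trans pr.
rewrite (funext maximum_rat); apply: measurable_ereal_sup_rat => r; exact: g_measurable.
Qed.

(** The values [r] for which [M x = g r x] may form an uncountable family, so
the existential over [r] in [D] is not a countable union of measurable sets as
it stands.  It becomes one after splitting [D] into closed intervals with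
rational endpoints. *)
Lemma measurable_maximizer_open (D : set R) : open D -> D `<=` [set r | 0 < r] ->
  measurable [set x | E x `&` D !=set0].
Proof.
move=> oD D0.
pose P := [set pq : rat * rat | ratr pq.1 < ratr pq.2 :> R /\
  `[ratr pq.1 : R, ratr pq.2] `<=` D].
rewrite (_ : [set x | _] = \bigcup_(pq in P)
   [set x | E x `&` `[ratr pq.1, ratr pq.2] !=set0]); last first.
  apply/seteqP; split=> x /=; last first.
    by move=> [pq [_ PD] [r [Er /PD Dr]]]; exists r.
  move=> [r [Er Dr]].
  have /nbhs_ballP[e /= e0 eD] : nbhs r D by exact: open_nbhs_nbhs.
  have [p] := @rat_in_itvoo _ (r - e) r ltac:(by rewrite ltrBlDr ltrDl).
  rewrite in_itv/= => /andP[ep pr].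
  have [q] := @rat_in_itvoo _ r (r + e) ltac:(by rewrite ltrDl).
  rewrite in_itv/= => /andP[rq qe].
  exists (p, q); last first.
    by exists r; split => //=; rewrite in_itv/= !ltW.
  split=> /=; first exact: lt_trans rq.
  move=> t /=; rewrite in_itv/= => /andP[pt tq]; apply: eD.
  rewrite /ball/= ltr_distlC; apply/andP; split.
    exact: lt_le_trans pt.
  exact: le_lt_trans qe.
rewrite bigcup_mkcond; apply: countable_bigcupT_measurable => [//|pq].
case: ifPn => // /set_mem[pq12 pqD].
apply: measurable_maximizer_itvcc => //.
by apply: D0; apply: pqD; rewrite /= in_itv/= lexx ltW.
Qed.

(** The lower bound [y <= inf (E x)] is tested, rather than [y < inf (E x)]:
for [y > 0] the former only involves the part of [E x] in the open interval
[`]0, y[], to which [measurable_maximizer_open] applies. *)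
Lemma measurable_inf_maximizer : measurable_fun setT ((fun x => inf (E x)) : T -> R).
Proof.
have infE0 x : 0 <= inf (E x).
  have [->|/set0P E0] := eqVneq (E x) set0; first by rewrite inf0.
  by apply: lb_le_inf => // r [/ltW].
move=> mT; apply: (measurability _ (RGenCInfty.measurableE R)) => //.
move=> _ [_ [y ->] <-]; rewrite setTI.
have [y0|y0] := leP y 0.
  rewrite (_ : _ @^-1` _ = setT)//; apply/seteqP; split=> x //= _.
  by rewrite in_itv/= andbT (le_trans y0).
rewrite (_ : _ @^-1` _ = [set x | E x `&` [set r | 0 < r] !=set0] `\`
    [set x | E x `&` `]0, y[ !=set0]).
  apply: measurableD; apply: measurable_maximizer_open => //.
  by move=> r /=; rewrite in_itv/= => /andP[].
apply/seteqP; split=> x /=; rewrite in_itv/= andbT.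
  move=> yE; split.
    have [E0|/set0P[r Er]] := eqVneq (E x) set0.
      by move: yE; rewrite E0 inf0 leNgt y0.
    by exists r; split=> //; case: Er.
  move=> [r [Er]]; rewrite /= in_itv/= => /andP[_]; apply/negP; rewrite -leNgt.
  rewrite (le_trans yE)//; apply: ge_inf => //.
  by exists 0 => s [/ltW].
move=> [[r [Er _]] Ny]; apply: lb_le_inf; first by exists r.
move=> s Es; rewrite leNgt; apply/negP => sy; apply: Ny; exists s; split=> //=.
by rewrite in_itv/= sy andbT; case: Es.
Qed.

End least_maximizer.

(** * Translation invariance of the completed Lebesgue measure *)

Section translation.
Context {R : realType}.
Local Notation len := (wlength (@idfun R)).
Local Notation leb := (@completed_lebesgue_measure R).

Lemma preimage_addl_itvoc (c a b : R) :
  +%R c @^-1` `]a, b] = `]a - c, b - c]%classic.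
Proof.
apply/seteqP; split=> x /=; rewrite !in_itv/= => /andP[ax xb];
  apply/andP; split; lra.
Qed.

Lemma measurable_ocitv_addl (c : R) (A : set (ocitv_type R)) :
  measurable A -> measurable (+%R c @^-1` A : set (ocitv_type R)).
Proof. by move=> [[a b] _ <-]; rewrite preimage_addl_itvoc; exact: is_ocitv. Qed.

Lemma wlength_addl (c : R) (A : set (ocitv_type R)) :
  measurable A -> len (+%R c @^-1` A) = len A.
Proof.
move=> [[a b] _ <-]; rewrite preimage_addl_itvoc !wlength_itv/= !lte_fin ltrD2r.
by case: ifP => // _; rewrite -!EFinB opprB addrA subrK.
Qed.

Let mu_ext_addl_le (c : R) (A : set R) :
  (len^* (+%R c @^-1` A) <= len^* A)%mu%E.
Proof.
apply: le_ereal_inf_tmp => _ [F [mF AF] <-].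
apply: ereal_inf_lbound; exists (fun k => +%R c @^-1` F k).
  split=> [k|x /= /AF [k _ Fk]]; last by exists k.
  exact: measurable_ocitv_addl.
by apply: eq_eseriesr => k _; rewrite wlength_addl.
Qed.

(** Translating a cover gives one inequality; the other one is the same
inequality for the opposite translation. *)
Lemma mu_ext_addl (c : R) (A : set R) :
  (len^* (+%R c @^-1` A) = len^* A)%mu.
Proof.
apply/eqP; rewrite eq_le mu_ext_addl_le/=.
have /le_trans : (len^* A <= len^* (+%R (- c) @^-1` (+%R c @^-1` A)))%mu%E.
  rewrite le_eqVlt; apply/orP; left; apply/eqP; congr (mu_ext _ _).
  by apply/seteqP; split=> x /=; rewrite addrA subrr add0r.
by apply; exact: mu_ext_addl_le.
Qed.

(** The Caratheodory criterion only mentions the outer measure, so it inherits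
its translation invariance: a test set [X] for the translate of [A] is moved to
a test set for [A]. *)
Lemma measurable_fun_addl (c : R) :
  measurable_fun [set: lebesgueTypeR R]
    (+%R c : lebesgueTypeR R -> lebesgueTypeR R).
Proof.
move=> _ A mA; rewrite setTI.
change ((len^*)%mu.-caratheodory (+%R c @^-1` A)) => X.
have addlK Y : +%R c @^-1` (+%R (- c) @^-1` Y) = Y :> set R.
  by apply/seteqP; split=> x /=; rewrite addrA addNr add0r.
have {mA} cA Y : (len^* Y = len^* (Y `&` A) + len^* (Y `&` ~` A))%mu%E.
  exact: mA.
rewrite /= -[LHS](mu_ext_addl (- c)) cA.
rewrite -(mu_ext_addl c (_ `&` A)) -(mu_ext_addl c (_ `&` ~` A)).
by rewrite !preimage_setI addlK.
Qed.

Lemma borel_lebesgue_measurable (A : set R) : measurable A ->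
  measurable (A : set (lebesgueTypeR R)).
Proof. by move=> mA; apply: sub_caratheodory. Qed.

Lemma ge0_integral_addl (c : R) (A : set R) (f : R -> \bar R) :
  measurable (A : set (lebesgueTypeR R)) ->
  measurable_fun setT (f : lebesgueTypeR R -> \bar R) ->
  (forall x, 0 <= f x)%E ->
  (\int[leb]_(y in (+%R c @^-1` A : set (lebesgueTypeR R))) f (c + y)%R =
   \int[leb]_(y in (A : set (lebesgueTypeR R))) f y)%E.
Proof.
move=> mA mf f0.
rewrite -(@ge0_integral_pushforward _ _ _ _ _ _ (measurable_fun_addl c) leb A f)//.
  apply: eq_measure_integral => [|? B mB _]; first exact: measurable_fun_addl.
  exact: mu_ext_addl.
exact: measurable_funTS.
Qed.

End translation.

(** * Continuity of the primitive of an integrable function *)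

Section primitive.
Context {R : realType}.
Local Notation leb := (@completed_lebesgue_measure R).

(** Starting the integral at [-oo], which integrability on the line allows,
keeps the domain an unsigned interval for every [t]. *)
Definition primitive (h : R -> R) (t : R) : R :=
  \int[leb]_(y in (`]-oo, t]%classic : set (lebesgueTypeR R))) h y.

Variable h : R -> R.
Hypothesis inth : in_L1 h.

Let measurable_lebesgue_itv (i : interval R) :
  measurable ([set` i] : set (lebesgueTypeR R)).
Proof. by apply: borel_lebesgue_measurable; exact: measurable_itv. Qed.

Let inth_itv (i : interval R) :
  leb.-integrable ([set` i] : set (lebesgueTypeR R))
    (EFin \o h : lebesgueTypeR R -> \bar R).
Proof. by apply: integrableS inth. Qed.

Lemma primitiveB (s t : R) : s <= t -> primitive h t - primitive h s =
  \int[leb]_(y in (`]s, t]%classic : set (lebesgueTypeR R))) h y.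
Proof.
move=> st; rewrite /primitive.
have e : `]-oo, t]%classic = `]-oo, s] `|` `]s, t] :> set R.
  by rewrite -itv_bndbnd_setU ?bnd_simp.
rewrite e Rintegral_setU//=; first by rewrite addrC addKr.
- by rewrite -e; exact: inth_itv.
- apply/disj_set2P; rewrite -subset0 => z /=; rewrite !in_itv/= => -[zs /andP[]].
  by rewrite ltNge zs.
Qed.

(** The half-open interval of [primitiveB] may be closed because singletons are
negligible. *)
Lemma integral_itvcc_primitive (s t : R) : s <= t ->
  (\int[leb]_(y in (`[s, t]%classic : set (lebesgueTypeR R))) (h y)%:E =
   (primitive h t - primitive h s)%:E)%E.
Proof.
move=> st; rewrite primitiveB// /Rintegral fineK; last first.
  by apply: integrable_fin_num; [exact: measurable_lebesgue_itv|exact: inth_itv].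
rewrite [LHS](@negligible_integral _ _ _ leb _ [set s])//.
- by rewrite setDitv1l.
- by rewrite -set_itv1; exact: measurable_lebesgue_itv.
- exact: (lebesgue_measure_set1 s).
Qed.

(** The increment over a short interval is small by absolute continuity of the
integral. *)
Lemma continuous_primitive : continuous (primitive h).
Proof.
move=> t; apply/cvgrPdist_lt => /= e e0.
have [d [d0 hd]] := integral_normr_continuous inth e0.
have near_le a b : a <= b -> b - a < d -> `|primitive h b - primitive h a| < e.
  move=> ab bad; rewrite primitiveB//.
  apply: le_lt_trans (hd _ (measurable_lebesgue_itv `]a, b]) _).
    apply: le_normr_Rintegral; [exact: measurable_lebesgue_itv|exact: inth_itv].
  rewrite [ltLHS](lebesgue_measure_itv `]a, b])/=.
  by case: ifP => _; rewrite ?lte_fin// -EFinB lte_fin.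
near=> u.
have : `|t - u| < d by near: u; exact: cvgr_dist_lt.
have [tu|/ltW ut] := leP t u.
  by rewrite distrC ger0_norm ?subr_ge0// distrC; exact: near_le.
by rewrite ger0_norm ?subr_ge0//; exact: near_le.
Unshelve. all: by end_near. Qed.

End primitive.

(** * The frequency function *)

Section average.
Context {R : realType}.
Variable f : R -> R.
Hypothesis intf : in_L1 f.

Let intnf : in_L1 (fun y => `|f y|).
Proof. exact: integrable_abse intf. Qed.

Let A (r x : R) := (2 * r)^-1 *
  (primitive (fun y => `|f y|) (x + r) - primitive (fun y => `|f y|) (x - r)).

Let averageE (r x : R) : 0 < r -> average (fun y => `|f y|) r x = (A r x)%:E.
Proof.
move=> r0; rewrite /average /A EFinM; congr (_ * _)%E.
rewrite -integral_itvcc_primitive//; last by lra.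
rewrite -(@ge0_integral_addl _ x _ (fun y => `|f y|%:E))//.
- congr (integral _ _ _).
  apply/seteqP; split=> y /=; rewrite !in_itv/= => /andP[ry yr];
    apply/andP; split; lra.
- by apply: borel_lebesgue_measurable; exact: measurable_itv.
- by case/integrableP : intnf.
Qed.

(** The averages fulfil the two hypotheses of [measurable_inf_maximizer]; for
the measurability in [x], continuity first gives a Borel function, which is
then Lebesgue measurable. *)
Lemma measurable_frequency :
  measurable_fun [set: lebesgueTypeR R] (frequency f : lebesgueTypeR R -> R).
Proof.
have -> : frequency f = fun x => inf [set r | 0 < r /\
    ereal_sup [set (A s x)%:E | s in [set s | 0 < s]] = (A r x)%:E].
  apply/funext => x; rewrite /frequency.
  have -> : maximizing_radii f x = [set r | 0 < r /\
      ereal_sup [set (A s x)%:E | s in [set s | 0 < s]] = (A r x)%:E].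
    have Me : maximal_function f x =
        ereal_sup [set (A s x)%:E | s in [set s | 0 < s]].
      congr ereal_sup; apply/seteqP.
      by split=> _ [s /= s0 <-]; exists s; rewrite ?averageE.
    rewrite /maximizing_radii Me.
    by apply/seteqP; split=> r /= [r0]; rewrite averageE.
  case: ifPn => // /asboolP/nonemptyPn ->.
  by rewrite inf0.
have cP := continuous_primitive intnf.
apply: (@measurable_inf_maximizer _ _ (lebesgueTypeR R) A).
- move=> x r r0; apply: cvgM.
    apply: cvgV; first by rewrite mulf_neq0// gt_eqF.
    by apply: cvgM; [exact: cvg_cst|exact: cvg_id].
  apply: cvgB.
    apply: (@continuous_comp _ _ _ (fun r => x + r) (primitive _)); last exact: cP.
    by apply: cvgD; [exact: cvg_cst|exact: cvg_id].
  apply: (@continuous_comp _ _ _ (fun r => x - r) (primitive _)); last exact: cP.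
  by apply: cvgB; [exact: cvg_cst|exact: cvg_id].
- move=> r r0 _ B mB.
  have cA : continuous (A r).
    move=> x; apply: cvgM; first exact: cvg_cst.
    apply: cvgB.
      apply: (@continuous_comp _ _ _ (fun x => x + r) (primitive _)); last exact: cP.
      by apply: cvgD; [exact: cvg_id|exact: cvg_cst].
    apply: (@continuous_comp _ _ _ (fun x => x - r) (primitive _)); last exact: cP.
    by apply: cvgB; [exact: cvg_id|exact: cvg_cst].
  apply: borel_lebesgue_measurable.
  exact: (continuous_measurable_fun cA measurableT mB).
Qed.

End average.

Theorem theorem1 (R : realType) (f : R -> R) (hf : in_L1 f) :
  (forall x : R, 0 <= frequency f x) /\
  measurable_fun [set: lebesgueTypeR R] (frequency f : lebesgueTypeR R -> R).
Proof.
split; last exact: measurable_frequency.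
move=> x; rewrite /frequency; case: ifPn => // /asboolP E0.
by apply: lb_le_inf => // r [/ltW].
Qed.
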